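(* Let $K=\{x\in\mathbb{Z}^n_+ : a^\top x\le b,\ 0\le x_i\le u_i\ \forall i\in N\}$ be a superincreasing knapsack with greedy solution $\theta$. Then $$\operatorname{conv}K=\Big\{x\in\mathbb{R}^n:\ 0\le x_i\le u_i\ \ \forall i\in N,\quad x_j+\sum_{i\in I_j}\phi_j(i)(x_i-\theta_i)\le\theta_j\ \ \forall j\in N\Big\}.$$
   Context: Let $n\ge 1$, $N=\{1,\dots,n\}$, and let $b$, $a_i$, $u_i$ ($i\in N$) be positive integers with $a_iu_i\le b$ for all $i\in N$ and $a^\top u>b$ (standing assumptions). $K$ is a superincreasing knapsack if $\sum_{k=1}^{i}a_ku_k\le a_{i+1}$ for all $1\le i\le n-1$. The greedy solution $\theta\in\mathbb{Z}^n_+$ is defined recursively for $i=n,n-1,\dots,1$ by $\theta_i=\min\{u_i,\lfloor (b-\sum_{k=i+1}^n a_k\theta_k)/a_i\rfloor\}$ (so $\theta_n=u_n$). Let $I=\{i\in N:\theta_i\ge1\}$ (so $n\in I$) and, for $j\in N$, $I_j=\{i\in I: i>j\}$ (so $I_n=\emptyset$). For $j\in N\setminus\{n\}$ and $i\in I_j$, $$\phi_j(i)=(u_j-\theta_j)\prod_{k\in I,\ j<k<i}(u_k+1-\theta_k),$$ with empty products equal to $1$. $\operatorname{conv}$ denotes convex hull in $\mathbb{R}^n$. *)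

(* Defs.v *)
From HB Require Import structures.
From mathcomp Require Import all_boot all_order all_algebra.
From mathcomp Require Import boolp classical_sets reals convex.

Set Implicit Arguments.
Unset Strict Implicit.
Unset Printing Implicit Defensive.

Import Order.TTheory GRing.Theory Num.Theory.

Definition conv_hull (R : realType) (V : lmodType R) (S : set V) : set V :=
  smallest (@convex_set R V) S.

(* The index set {1, ..., n} is represented by 'I_n = {0, ..., n-1}. *)
Definition superincreasing (n : nat) (a u : 'I_n -> nat) : Prop :=
  forall i j : 'I_n, j = i.+1 :> nat ->
    \sum_(k < n | k <= i) a k * u k <= a j.

(* The recursion runs downwards from the last index, so i only needs fuel
   n - i. The equation without fuel is greedyE; the subtraction below is never
   truncated, by greedy_budget. *)
Fixpoint greedy_rec (n : nat) (a u : 'I_n -> nat) (b fuel : nat) (i : 'I_n)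
    : nat :=
  if fuel is m.+1 then
    minn (u i) ((b - \sum_(k < n | i < k) a k * greedy_rec a u b m k) %/ a i)
  else 0.

Definition greedy (n : nat) (a u : 'I_n -> nat) (b : nat) : 'I_n -> nat :=
  greedy_rec a u b n.

Definition greedy_supp (n : nat) (a u : 'I_n -> nat) (b : nat) : {set 'I_n} :=
  [set i | 1 <= greedy a u b i]%SET.

Definition greedy_supp_above (n : nat) (a u : 'I_n -> nat) (b : nat)
    (j : 'I_n) : {set 'I_n} :=
  [set i in greedy_supp a u b | j < i]%SET.

(* No truncation occurs in the subtractions, by greedy_le. *)
Definition phi (n : nat) (a u : 'I_n -> nat) (b : nat) (j i : 'I_n) : nat :=
  (u j - greedy a u b j) *
  \prod_(k in greedy_supp a u b | j < k < i) (u k + 1 - greedy a u b k).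

Local Open Scope classical_set_scope.
Local Open Scope ring_scope.

Definition knapsack (R : realType) (n : nat) (a u : 'I_n -> nat) (b : nat)
    : set 'rV[R]_n :=
  [set x : 'rV[R]_n |
   [/\ forall i, x 0 i \is a Num.nat,
      \sum_(i < n) (a i)%:R * x 0 i <= b%:R &
      forall i, 0 <= x 0 i <= (u i)%:R]].

Arguments knapsack R {n} a u b.

Local Close Scope ring_scope.

Lemma greedyE (n : nat) (a u : 'I_n -> nat) (b : nat) (i : 'I_n) :
  greedy a u b i =
  minn (u i) ((b - \sum_(k < n | i < k) a k * greedy a u b k) %/ a i).
Proof.
suff fuelE m1 m2 (j : 'I_n) : n - j <= m1 -> n - j <= m2 ->
    greedy_rec a u b m1 j = greedy_rec a u b m2 j.
  have := fuelE n n.+1 i (leq_subr _ _) (leq_trans (leq_subr _ _) (leqnSn _)).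
  exact.
have fuel0 (k : 'I_n) : (n - k <= 0) = false.
  by rewrite leqn0 subn_eq0 leqNgt ltn_ord.
elim: m1 m2 j => [|m1 IH] [|m2] j; rewrite ?fuel0 //=.
move=> h1 h2; congr (minn _ ((_ - _) %/ _)).
apply: eq_bigr => k jk; congr (_ * _); apply: IH; rewrite -ltnS.
  by apply: leq_trans h1; apply: ltn_sub2l.
by apply: leq_trans h2; apply: ltn_sub2l.
Qed.

Lemma greedy_le (n : nat) (a u : 'I_n -> nat) (b : nat) (i : 'I_n) :
  greedy a u b i <= u i.
Proof. by rewrite greedyE geq_minl. Qed.

Lemma greedy_budget (n : nat) (a u : 'I_n -> nat) (b m : nat) :
  \sum_(k < n | m <= k) a k * greedy a u b k <= b.
Proof.
have [d] := ubnP (n - m); elim: d m => // d IH m; rewrite ltnS => hd.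
have [nm|mn] := leqP n m.
  by rewrite big_pred0 // => k; rewrite leqNgt (leq_trans (ltn_ord k) nm).
rewrite (bigD1 (Ordinal mn)) //=.
rewrite (eq_bigl (fun k : 'I_n => m < k)); last first.
  by move=> k; rewrite ltn_neqAle andbC eq_sym.
have hS : \sum_(k < n | m < k) a k * greedy a u b k <= b.
  by apply: IH; apply: leq_trans hd; apply: ltn_sub2l.
rewrite addnC -leq_subRL // greedyE mulnC.
by apply: leq_trans (leq_divM _ (a (Ordinal mn))); rewrite leq_mul ?geq_minr.
Qed.

(* Main.v *)
(** Reading coordinates from the last one down, a point of the box is feasible
    iff it is lexicographically at most theta. Put
      gap_m(x) = sum_(i in I, i >= m)
                   prod_(k in I, m <= k < i) (u_k + 1 - theta_k) *
                   (theta_i - x_i).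
    Then gap_j = (theta_j - x_j) + (u_j + 1 - theta_j) gap_(j+1) for j in I, and
    the inequality of index j reads
      x_j - (u_j - theta_j) gap_(j+1)(x) <= theta_j.

    Validity: by the recurrence, a feasible point either agrees with theta from
    m on or has gap_m >= 1.

    Completeness: by downward induction on m, a point x of the polytope,
    truncated to the coordinates >= m, is a convex combination of integer points
    lexicographically at most theta in which theta itself has weight at most
    max(0, 1 - gap_m(x)). Given such a combination for j+1 with weight lam on
    theta, the inequality of index j says that x_j is at most
    lam theta_j + (1 - lam) u_j; filling the points below theta up to u_j first,
    and theta afterwards, gives the combination for j. *)
Require Import Defs.
From HB Require Import structures.
From mathcomp Require Import all_boot all_order all_algebra.
From mathcomp Require Import boolp classical_sets reals convex.
From mathcomp Require Import interval_inference.
From mathcomp Require Import zify ring lra.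

Import Order.TTheory GRing.Theory Num.Theory.
Local Open Scope classical_set_scope.
Local Open Scope ring_scope.

Set Implicit Arguments.
Unset Strict Implicit.

(** * Convex hulls and weighted sums of points *)

Lemma convex_setP (R : realType) (V : lmodType R) (A : set V) :
  @convex_set R V A <->
  forall (x y : V) (t : R), 0 <= t <= 1 -> A x -> A y ->
    A (t *: x + (1 - t) *: y).
Proof.
split=> [cA x y t t01 Ax Ay|cA x y l].
  have := cA x y (Itv01 (proj1 (andP t01)) (proj2 (andP t01))).
  by move=> /(_ (mem_set Ax) (mem_set Ay)) /set_mem.
move=> /set_mem Ax /set_mem Ay; apply/mem_set.
by apply: (cA x y l%:num) => //; rewrite ge0 le1.
Qed.

Lemma convex_conv_hull (R : realType) (V : lmodType R) (S : set V) :
  @convex_set R V (conv_hull S).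
Proof.
apply/convex_setP => x y t t01 Sx Sy A cSA.
have /convex_setP cA := proj1 cSA.
by apply: cA => //; [apply: Sx|apply: Sy].
Qed.

(* [cone S mu w] says that w is in mu * conv S, and it is [w = 0] at [mu = 0],
   so that no division is needed to split off part of the mass. *)
Inductive cone {R : realType} {V : lmodType R} (S : set V) : R -> V -> Prop :=
| cone0 : cone S 0 0
| cone_step s c mu w :
    S s -> 0 <= c -> cone S mu w -> cone S (c + mu) (c *: s + w).

Section Cone.
Context {R : realType} {V : lmodType R}.
Implicit Types (S T : set V) (w v : V) (mu c t : R).

Lemma cone_ge0 S mu w : cone S mu w -> 0 <= mu.
Proof. by elim=> // s c mu' w' _ c0 _ mu0; rewrite addr_ge0. Qed.

Lemma coneD S mu mu' w w' :
  cone S mu w -> cone S mu' w' -> cone S (mu + mu') (w + w').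
Proof.
move=> Sw Sw'; elim: Sw => [|s c nu v Ss c0 _ IH]; first by rewrite !add0r.
by rewrite -!addrA; apply: cone_step.
Qed.

Lemma cone_pt S s c : S s -> 0 <= c -> cone S c (c *: s).
Proof.
move=> Ss c0; rewrite -[X in cone _ X]addr0 -[c *: s]addr0.
by apply: cone_step => //; apply: cone0.
Qed.

(** Moving mass [t / k] from [s] to [s + k v] adds [t v] to the sum; [k = 0] forces [t = 0]. *)
Lemma cone_segment S s v (k : nat) c t :
  S s -> S (s + k%:R *: v) -> 0 <= c -> 0 <= t <= c * k%:R ->
  cone S c (c *: s + t *: v).
Proof.
move=> Ss Sv c0 /andP[t0 tc]; have [k0|k0] := posnP k.
  have -> : t = 0 by move: tc; rewrite k0 mulr0; lra.
  by rewrite scale0r addr0; apply: cone_pt.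
have kR : 0 < k%:R :> R by rewrite ltr0n.
have tk : t / k%:R <= c by rewrite ler_pdivrMr.
have := coneD (cone_pt Ss (_ : 0 <= c - t / k%:R))
              (cone_pt Sv (divr_ge0 t0 (ltW kR))).
rewrite subr_ge0 => /(_ tk).
by rewrite subrK scalerDr scalerA addrA -scalerDl subrK divfK ?gt_eqF.
Qed.

(** The points are filled one at a time: each is moved up to [k] steps along [v] before the rest of
    [t] passes on to the next. *)
Lemma cone_shift S T v (k : nat) mu w t :
  (forall s, S s -> T s /\ T (s + k%:R *: v)) ->
  cone S mu w -> 0 <= t <= mu * k%:R -> cone T mu (w + t *: v).
Proof.
move=> ST Sw; elim: Sw t => [|s c nu w' /ST[Ts Tv] c0 Sw' IH] t.
  rewrite mul0r => t0; have -> : t = 0 by lra.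
  by rewrite scale0r addr0; apply: cone0.
move=> /andP[t0 tc]; have nu0 := cone_ge0 Sw'.
have k0 : 0 <= k%:R :> R by rewrite ler0n.
have ck : 0 <= c * k%:R by rewrite mulr_ge0.
have nk : 0 <= nu * k%:R by rewrite mulr_ge0.
have [tck|ckt] := leP t (c * k%:R).
  rewrite addrAC; apply: coneD.
    by apply: cone_segment Ts Tv _ _ => //; rewrite t0.
  by rewrite -[w']addr0 -[0](scale0r v); apply: IH; rewrite lexx.
have -> : c *: s + w' + t *: v =
    (c *: s + (c * k%:R) *: v) + (w' + (t - c * k%:R) *: v).
  by rewrite scalerBl addrACA [_ *: v + (_ - _)]addrC subrK.
apply: coneD; first by apply: cone_segment Ts Tv _ _ => //; rewrite ck lexx.
by apply: IH; move: tc; rewrite mulrDl; lra.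
Qed.

(** Normalisation by the total mass; [p0] is the default point when [mu = 0]. *)
Lemma cone_convex S (A : set V) p0 mu w :
  @convex_set R V A -> S `<=` A -> A p0 -> cone S mu w ->
  exists2 p, A p & w = mu *: p.
Proof.
move=> /convex_setP cA SA Ap0; elim=> [|s c nu w' Ss c0 Sw' [p Ap ->]].
  by exists p0; rewrite ?scale0r.
have nu0 := cone_ge0 Sw'.
have [cn0|cn] := eqVneq (c + nu) 0.
  have -> : c = 0 by lra.
  have -> : nu = 0 by lra.
  by exists p0; rewrite // !scale0r !addr0 scale0r.
have cn_gt0 : 0 < c + nu by rewrite lt_def cn addr_ge0.
exists (c / (c + nu) *: s + (1 - c / (c + nu)) *: p).
  apply: cA => //; last exact: SA.
  by rewrite divr_ge0 ?ler_pdivrMr ?mul1r ?lerDl ?(ltW cn_gt0).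
rewrite scalerDr !scalerA; congr (_ *: _ + _ *: _); field => //.
Qed.

End Cone.

Lemma ltn_ord_neq {n : nat} (i j : 'I_n) :
  (i < j)%N = (j != i) && (i <= j)%N.
Proof. by rewrite ltn_neqAle eq_sym. Qed.

Lemma ltn_ord_eqF {n : nat} (i j : 'I_n) : (i < j)%N -> (i == j) = false.
Proof. by apply: contraTF => /eqP ->; rewrite ltnn. Qed.

Lemma gtn_ord_eqF {n : nat} (i j : 'I_n) : (j < i)%N -> (i == j) = false.
Proof. by rewrite eq_sym; apply: ltn_ord_eqF. Qed.

(** * The gap function and its recurrence *)

Section Knapsack.
Context {R : realType} {n : nat} (a u : 'I_n -> nat) (b : nat).
Local Notation theta := (greedy a u b).
Local Notation I := (greedy_supp a u b).
Implicit Types (x z : 'rV[R]_n) (y : 'I_n -> nat) (m : nat).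

(* Lexicographically below the truncation of theta to the coordinates >= m, the
   last coordinate being the most significant one. *)
Definition lexlt m y :=
  [/\ forall i, (y i <= u i)%N, forall i : 'I_n, (i < m)%N -> y i = 0%N &
   exists2 p : 'I_n, (m <= p)%N && (y p < theta p)%N &
     forall k : 'I_n, (p < k)%N -> y k = theta k].

Definition vec y : 'rV[R]_n := \row_i (y i)%:R.

Definition lexset m : set 'rV[R]_n := [set vec y | y in lexlt m].

Definition trunc m x : 'rV[R]_n := \row_i (if (m <= i)%N then x 0 i else 0).

Definition gap m x : R :=
  \sum_(i in I | (m <= i)%N)
    (\prod_(k in I | (m <= k < i)%N) (u k + 1 - theta k))%:R *
    ((theta i)%:R - x 0 i).

Lemma gap_end m x : (n <= m)%N -> gap m x = 0.
Proof.
move=> nm; rewrite /gap big1 // => i /andP[_ mi].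
by have := ltn_ord i; rewrite ltnNge (leq_trans nm mi).
Qed.

Lemma gap_notin (j : 'I_n) x : theta j = 0%N -> gap j x = gap j.+1 x.
Proof.
move=> tj; have jI : j \notin I by rewrite inE tj.
have geE (k : 'I_n) : (k \in I) && (j <= k)%N = (k \in I) && (j < k)%N.
  have [kI|//] := boolP (k \in I); rewrite /= [LHS]leq_eqVlt.
  by case: eqP => //= /ord_inj jk; rewrite jk kI in jI.
apply: eq_big => i; first exact: geE.
move=> _; congr (_%:R * _); apply: eq_bigl => k.
by rewrite !andbA geE.
Qed.

(** The factor of [j] splits off the product of every later index. *)
Lemma gap_in (j : 'I_n) x : (0 < theta j)%N ->
  gap j x = ((theta j)%:R - x 0 j) + (u j + 1 - theta j)%:R * gap j.+1 x.
Proof.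
move=> tj; have jI : j \in I by rewrite inE.
rewrite /gap (bigD1 j) /= ?jI ?leqnn //; congr (_ + _).
  rewrite big_pred0 ?mul1r // => k.
  by rewrite andbC -andbA; case: leqP => //=; case: ltnP.
rewrite mulr_sumr; apply: eq_big => i.
  by rewrite ltn_ord_neq -andbA [(j <= i)%N && _]andbC.
move=> /andP[/andP[iI ji] ij]; rewrite mulrA -natrM; congr (_%:R * _).
have jlti : (j < i)%N by rewrite ltn_neqAle eq_sym ij.
rewrite (bigD1 j) /= ?jI ?leqnn ?jlti //; congr (_ * _)%N.
apply: eq_bigl => k.
by rewrite (ltn_ord_neq j); case: (k \in I); case: (k == j); case: (j <= k)%N;
   case: (k < i)%N.
Qed.

Lemma sum_phi (j : 'I_n) x :
  \sum_(i in greedy_supp_above a u b j)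
     (phi a u b j i)%:R * (x 0 i - (theta i)%:R)
  = - ((u j - theta j)%:R * gap j.+1 x).
Proof.
rewrite /gap mulr_sumr -sumrN; apply: eq_big => i; first by rewrite !inE.
by move=> _; rewrite /phi natrM -mulrA -mulrN -mulrN opprB.
Qed.

(** * Feasibility and the lexicographic order *)

Section Superincreasing.
Hypotheses (a_gt0 : forall i, (0 < a i)%N) (a_si : superincreasing a u).

Lemma sum_below_le (p : 'I_n) :
  (\sum_(k < n | (k < p)%N) a k * u k <= a p)%N.
Proof.
case: p => -[|p] pn; first by rewrite big_pred0.
apply: leq_trans (@a_si (Ordinal (ltnW pn)) (Ordinal pn) erefl).
by apply/eq_leq/eq_bigl.
Qed.

Lemma sum_split (p : 'I_n) (F : 'I_n -> nat) :
  (\sum_(k < n) F k =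
   \sum_(k < n | (k < p)%N) F k + (F p + \sum_(k < n | (p < k)%N) F k))%N.
Proof.
rewrite (bigID (fun k : 'I_n => (k < p)%N)) /=; congr (_ + _)%N.
rewrite (bigD1 p) /= ?ltnn //; congr (_ + _)%N.
by apply: eq_bigl => k; rewrite -leqNgt ltn_ord_neq andbC.
Qed.

Lemma greedy_knapsack : knapsack R a u b (vec theta).
Proof.
split=> [i||i]; rewrite ?mxE ?natr_nat //; last first.
  by rewrite ler0n ler_nat greedy_le.
under eq_bigr do rewrite mxE -natrM.
by rewrite -natr_sum ler_nat (greedy_budget a u b 0).
Qed.

(** At the topmost difference [p] at least [a p] is saved, which pays for all coordinates below
    [p]. *)
Lemma lexset_knapsack m : lexset m `<=` knapsack R a u b.
Proof.
move=> _ [y [yu _ [p /andP[_ yp] yk]] <-].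
split=> [i||i]; rewrite ?mxE ?natr_nat //; last by rewrite ler0n ler_nat yu.
under eq_bigr do rewrite mxE -natrM.
rewrite -natr_sum ler_nat (sum_split p).
rewrite [X in (_ + (_ + X))%N](eq_bigr (fun k => a k * theta k)%N); last first.
  by move=> k /yk ->.
have := greedy_budget a u b p; rewrite (bigD1 p) //=.
rewrite (eq_bigl (fun k : 'I_n => p < k)%N); last first.
  by move=> k; rewrite ltn_ord_neq andbC.
have low : (\sum_(k < n | (k < p)%N) a k * y k <= a p)%N.
  apply: leq_trans (sum_below_le p).
  by apply: leq_sum => k _; rewrite leq_mul2l yu orbT.
have : (a p * y p + a p <= a p * theta p)%N.
  by rewrite -mulnSr leq_mul2l yp orbT.
move=> top /(leq_trans _) -> //; rewrite addnA leq_add2r.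
by apply: leq_trans top; rewrite addnC leq_add2l.
Qed.

(** After a tie above [j], the budget left for [x_j] is the one in the greedy recursion. *)
Lemma knapsack_le_greedy x (j : 'I_n) : knapsack R a u b x ->
  (forall k : 'I_n, (j < k)%N -> x 0 k = (theta k)%:R) ->
  x 0 j <= (theta j)%:R.
Proof.
case=> xn xb xu tie.
have [y xE] : exists y, x = vec y.
  have /choice[y yE] : forall i, exists m : nat, x 0 i = m%:R.
    by move=> i; apply/natrP.
  by exists y; apply/rowP => i; rewrite mxE.
move: xb xu tie; rewrite {}xE => xb xu tie; rewrite mxE ler_nat.
rewrite greedyE leq_min; apply/andP; split.
  by have := xu j; rewrite mxE ler_nat => /andP[].
rewrite leq_divRL //; move: xb.
under eq_bigr do rewrite mxE -natrM.
rewrite -natr_sum ler_nat (sum_split j).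
rewrite [X in (_ + (_ + X))%N](eq_bigr (fun k => a k * theta k)%N); last first.
  by move=> k /tie /eqP; rewrite mxE eqr_nat => /eqP ->.
move=> yb; rewrite leq_subRL ?(greedy_budget a u b j.+1) //.
by apply: leq_trans yb; rewrite [(y j * _)%N]mulnC addnC leq_addl.
Qed.

Lemma knapsack_tie_or_gap x m : knapsack R a u b x ->
  (forall k : 'I_n, (m <= k)%N -> x 0 k = (theta k)%:R) \/ 1 <= gap m x.
Proof.
move=> Kx; have [d] := ubnP (n - m)%N; elim: d m => // d IH m dm.
have [nm|mn] := leqP n m.
  by left=> k mk; have := ltn_ord k; rewrite ltnNge (leq_trans nm mk).
pose j := Ordinal mn; rewrite -[m]/(j : nat).
have xj0 : 0 <= x 0 j <= (u j)%:R by case: Kx.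
have tu := greedy_le a u b j.
have uE : (u j + 1 - theta j)%:R = (u j)%:R + 1 - (theta j)%:R :> R.
  by rewrite natrB ?natrD //; lia.
have tuR : (theta j)%:R <= (u j)%:R :> R by rewrite ler_nat.
case: (IH m.+1); first by lia.
- move=> tie; have xj : x 0 j <= (theta j)%:R := @knapsack_le_greedy x j Kx tie.
  have gap0 : gap m.+1 x = 0.
    by rewrite /gap big1 // => i /andP[_ mi]; rewrite tie // subrr mulr0.
  have [xE|xN] := eqVneq (x 0 j) (theta j)%:R.
    left=> k; rewrite leq_eqVlt => /orP[/eqP mk|/tie //].
    by have -> : k = j by apply: val_inj.
  right; have xlt : x 0 j < (theta j)%:R by rewrite lt_def eq_sym xN.
  have tj : (0 < theta j)%N by rewrite -(ltr_nat R); lra.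
  rewrite gap_in // gap0 mulr0 addr0.
  (* Integrality turns [x_j < theta_j] into a difference of at least 1. *)
  have /natrP[y yE] : x 0 j \is a Num.nat by case: Kx.
  move: xlt; rewrite yE ltr_nat => /[dup] /ltnW yt.
  by rewrite -natrB // ler1n subn_gt0.
- move=> g1; right; have [t0|tj] := posnP (theta j); first by rewrite gap_notin.
  (* As the later gap is at least 1, this one is at least [u_j + 1 - x_j]. *)
  rewrite gap_in // uE; nra.
Qed.

(** * Decomposition of points of the polytope *)

Lemma lexset_above (j : 'I_n) s : lexset j.+1 s ->
  lexset j s /\ lexset j (s + (u j)%:R *: delta_mx 0 j).
Proof.
(* The decisive difference lies above [j], so coordinate [j] is free in its box. *)
move=> [y [yu y0 [p /andP[jp yp] yk]] <-]; split.
  exists y => //; split=> // [i ij|]; first by apply: y0; apply: ltnW.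
  by exists p => //; rewrite yp ltnW.
exists (fun i => if i == j then u j else y i).
  split=> [i|i ij|].
  - by case: eqP => // ->.
  - by rewrite ltn_ord_eqF // y0 // ltnW.
  - exists p => [|k pk].
      by rewrite (ltnW jp) gtn_ord_eqF.
    by rewrite yk // gtn_ord_eqF // (ltn_trans jp pk).
apply/rowP => i; rewrite !mxE eqxx /=; case: eqP => [->|_].
  by rewrite y0 // add0r mulr1.
by rewrite mulr0 addr0.
Qed.

Lemma lexset_greedy (j : 'I_n) (k : nat) : (k < theta j)%N ->
  lexset j (trunc j.+1 (vec theta) + k%:R *: delta_mx 0 j).
Proof.
move=> kt; exists (fun i : 'I_n =>
  if i == j then k else if (j < i)%N then theta i else 0%N).
  split=> [i|i ij|].
  - have tu := greedy_le a u b; case: eqP => [->|_]; last by case: ifP.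
    by rewrite ltnW // (leq_trans kt).
  - by rewrite ltn_ord_eqF // ltnNge (ltnW ij).
  - exists j => [|i ji]; first by rewrite leqnn eqxx.
    by rewrite ji gtn_ord_eqF.
apply/rowP => i; rewrite !mxE eqxx /=; case: eqP => [->|_].
  by rewrite ltnn add0r mulr1.
by rewrite mulr0 addr0; case: ifP.
Qed.

Lemma trunc_rec (j : 'I_n) x :
  trunc j x = trunc j.+1 x + x 0 j *: delta_mx 0 j.
Proof.
apply/rowP => i; rewrite !mxE eqxx /= leq_eqVlt -(inj_eq val_inj) eq_sym.
case: eqP => /= [/val_inj ->|_]; first by rewrite ltnn add0r mulr1.
by rewrite mulr0 addr0.
Qed.

(** The disjunction expresses [lam <= max(0, 1 - gap m x)], given [0 <= lam]. *)
Lemma lex_decomposition x m :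
  (forall i, 0 <= x 0 i <= (u i)%:R) ->
  (forall j : 'I_n, x 0 j - (u j - theta j)%:R * gap j.+1 x <= (theta j)%:R) ->
  exists lam z,
    [/\ 0 <= lam <= 1, lam = 0 \/ lam <= 1 - gap m x,
        cone (lexset m) (1 - lam) z &
        trunc m x = lam *: trunc m (vec theta) + z].
Proof.
move=> xu xgap; have [d] := ubnP (n - m)%N; elim: d m => // d IH m dm.
have [nm|mn] := leqP n m.
  exists 1, 0; rewrite gap_end // subr0 subrr; split; rewrite ?ler01 ?lexx //.
  - by right.
  - exact: cone0.
  - apply/rowP => i; rewrite !mxE leqNgt (leq_trans (ltn_ord i) nm) /=.
    by rewrite mulr0 addr0.
pose j := Ordinal mn; rewrite -[m]/(j : nat).
have [|lam [z [/andP[lam0 lam1] lam_gap zcone xE]]] := IH m.+1; first by lia.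
have := xgap j; rewrite -[m.+1]/(j.+1) in lam_gap zcone xE *.
have /andP[] := xu j; have tu := greedy_le a u b j.
have : (theta j)%:R <= (u j)%:R :> R by rewrite ler_nat.
have := ler0n R (theta j).
rewrite (natrB _ tu) !(trunc_rec j) xE [vec theta 0 j]mxE.
set X := x 0 j; set U := (u j)%:R; set T := (theta j)%:R.
move=> T0 TU X0 XU XT.
(* t1 goes to the points below theta, and t0 to theta. *)
pose t1 := Num.min X ((1 - lam) * U); pose t0 := X - t1.
have U0 : 0 <= (1 - lam) * U by rewrite mulr_ge0 ?subr_ge0 // ler0n.
have t1E : t1 = X \/ t1 = (1 - lam) * U.
  by rewrite /t1 /Num.min; case: ifP; [left|right].
have /andP[t1X t1U] : (t1 <= X) && (t1 <= (1 - lam) * U).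
  by rewrite !ge_min !lexx orbT.
have t10 : 0 <= t1 by case: t1E => ->.
have t00 : 0 <= t0 by rewrite subr_ge0.
(* For [lam = 0] this rests on [x_j <= u_j]; otherwise on the inequality of index [j] and
   [gap j.+1 x <= 1 - lam]. *)
have t0T : t0 <= lam * T.
  rewrite /t0; case: t1E => ->; first by rewrite subrr mulr_ge0.
  by case: lam_gap => [->|]; nra.
have z'cone : cone (lexset j) (1 - lam) (z + t1 *: delta_mx 0 j).
  apply: (@cone_shift _ _ _ _ _ (u j)) zcone _; last by rewrite t10.
  by move=> s; apply: lexset_above.
(* If theta_j = 0 then theta keeps its weight: no point below theta at j arises
   from it. *)
have [tj0|tj] := posnP (theta j).
  have T00 : T = 0 by rewrite /T tj0.
  have t0E : t0 = 0 by rewrite T00 mulr0 in t0T; lra.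
  exists lam, (z + t1 *: delta_mx 0 j); split => //.
  - by rewrite lam0.
  - by rewrite gap_notin.
  - have -> : t1 = X by move: t0E; rewrite /t0; lra.
    by rewrite T00 scale0r addr0 addrA.
have T1 : 1 <= T by rewrite ler1n.
(* The mass lam at theta, with j-th coordinate t0, is spread over the values
   0, ..., theta_j - 1 as far as possible; lam' has to stay at theta_j. *)
pose lam' := Num.max 0 (t0 - lam * (T - 1)).
have lam'E : lam' = 0 /\ t0 <= lam * (T - 1) \/
             lam' = t0 - lam * (T - 1) /\ 0 <= lam'.
  rewrite /lam' maxEle; case: ifPn => h; [right|left]; split => //.
  by move: h; rewrite -ltNge; lra.
have lam'0 : 0 <= lam' by case: lam'E => -[] ->.
have lam'lam : lam' <= lam by case: lam'E => -[] -> //; lra.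
exists lam', (((lam - lam') *: trunc j.+1 (vec theta) +
  (t0 - lam' * T) *: delta_mx 0 j) + (z + t1 *: delta_mx 0 j)); split.
- by rewrite lam'0 (le_trans lam'lam).
- rewrite gap_in // natrB ?(leq_trans tu) ?leq_addr // natrD -/X -/U -/T.
  case: lam'E => -[-> h]; first by left.
  case: t1E => t1E.
    by left; move: h; rewrite /lam' /t0 t1E subrr; nra.
  case: lam_gap => [lamE|lam_gap].
    by left; move: h t00; rewrite /t0 t1E lamE; lra.
  (* Here [lam' = x_j - u_j + lam (u_j + 1 - theta_j)]; inserting the bound on [lam] gives
     [1 - gap j x]. *)
  by right; rewrite /t0 t1E; nra.
- have -> : 1 - lam' = (lam - lam') + (1 - lam) by ring.
  (* The segment ends at [theta_j - 1], so that both ends are strictly below [theta]. *)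
  apply: coneD => //; apply: (@cone_segment _ _ _ _ _ (theta j).-1).
  + rewrite -[trunc _ _]addr0 -[0](scale0r (delta_mx 0 j)).
    exact: (@lexset_greedy _ 0).
  + by apply: lexset_greedy; rewrite prednK.
  + by rewrite subr_ge0.
  + have -> : (theta j).-1%:R = T - 1 by rewrite -subn1 natrB.
    by case: lam'E => -[-> h]; nra.
- rewrite /t0; apply/rowP => i.
  move: (trunc j.+1 (vec theta)) (delta_mx 0 j) => v e.
  rewrite !mxE; ring.
Qed.

End Superincreasing.
End Knapsack.

Theorem theorem2 (R : realType) (n : nat) (a u : 'I_n -> nat) (b : nat)
    (n_ge1 : (1 <= n)%N)
    (b_gt0 : (0 < b)%N)
    (a_gt0 : forall i, (0 < a i)%N)
    (u_gt0 : forall i, (0 < u i)%N)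
    (au_le_b : forall i, (a i * u i <= b)%N)
    (b_lt_au : (b < \sum_(i < n) a i * u i)%N)
    (a_superincreasing : superincreasing a u) :
  conv_hull (knapsack R a u b) =
  [set x : 'rV[R]_n |
    (forall i, 0 <= x 0 i <= (u i)%:R) /\
    (forall j,
      x 0 j + \sum_(i in greedy_supp_above a u b j)
                (phi a u b j i)%:R * (x 0 i - (greedy a u b i)%:R)
      <= (greedy a u b j)%:R)].
Proof.
apply/seteqP; split.
  apply: smallest_sub.
    apply/convex_setP => x y t /andP[t0 t1] [xu xj] [yu yj].
    have s0 : 0 <= 1 - t by rewrite subr_ge0.
    split=> [i|j].
      rewrite !mxE; have /andP[x0 xU] := xu i; have /andP[y0 yU] := yu i.
      by apply/andP; split; nra.
    have := lerD (ler_wpM2l t0 (xj j)) (ler_wpM2l s0 (yj j)).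
    have tE (c : R) : t * c + (1 - t) * c = c by ring.
    rewrite [leRHS]tE; apply: le_trans.
    rewrite !mulrDr !mulr_sumr addrACA -big_split /= !mxE lerD2l.
    apply: ler_sum => i _; rewrite le_eqVlt; apply/orP; left.
    by apply/eqP; rewrite !mxE; ring.
  move=> x Kx; have [_ _ xu] := Kx; split=> // j; rewrite sum_phi.
  (* A tie leaves [x_j <= theta_j]; a gap of at least 1 lowers [x_j <= u_j] by at least
     [u_j - theta_j]. *)
  have [tie|g1] := knapsack_tie_or_gap a_gt0 j.+1 Kx.
    have -> : gap a u b j.+1 x = 0.
      by rewrite /gap big1 // => i /andP[_ ji]; rewrite tie // subrr mulr0.
    by rewrite mulr0 subr0; apply: knapsack_le_greedy.
  have tu := greedy_le a u b j; have /andP[_ xU] := xu j.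
  have : (greedy a u b j)%:R <= (u j)%:R :> R by rewrite ler_nat.
  by rewrite natrB //; nra.
move=> x [xu xphi].
have [|lam [z [/andP[lam0 lam1] _ zc xE]]] :=
    @lex_decomposition R n a u b x 0 xu.
  by move=> j; rewrite -sum_phi.
have cK := @convex_conv_hull R _ (knapsack R a u b).
have Ktheta : conv_hull (knapsack R a u b) (vec (greedy a u b)).
  by apply: sub_gen_smallest; apply: greedy_knapsack.
have trunc0 w : trunc 0 w = w :> 'rV[R]_n by apply/rowP => i; rewrite mxE.
have sK : lexset a u b 0 `<=` conv_hull (knapsack R a u b).
  by move=> s /(lexset_knapsack a_superincreasing); apply: sub_gen_smallest.
(* [theta] serves as default point in case [lam = 1]. *)
have [p Kp zE] := cone_convex cK sK Ktheta zc.
rewrite -[x]trunc0 xE trunc0 zE.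
by move/convex_setP: cK; apply; rewrite ?lam0.
Qed.
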